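(* Let $d,\alpha>1$, let $k\le n$ be integers, and fix a constant $\beta\ge1$. There is a random linear map $G:\mathbb{R}^d\to\mathbb{R}^t$ with $t=O(\log k+\tfrac{d}{\alpha^2})$ (hidden constant may depend on $\beta$) such that for every two sets $P\subset\mathbb{R}^d$ of size $n$ and $Q\subset\mathbb{R}^d$ of size $k$, with probability at least $2/3$: (1) $FPQ_k(G(P),G(Q))$ is an $O(\alpha)$-estimation of $FPQ_k(P,Q)$; and (2) every $p\in P$ is an $O(\alpha)$-approximate solution for $FPQ_k(P,Q)$ whenever $Gp$ is a $\beta$-approximate solution for $FPQ_k(G(P),G(Q))$.
   Context: Euclidean norms; $\mathrm{dist}(x,Q)=\min_{q\in Q}\|x-q\|$. For a data set $P$ and query set $Q$ with $|Q|\le k$, $FPQ_k(P,Q)=\max_{p\in P}\mathrm{dist}(p,Q)$ (furthest point query). A point $p\in P$ is a $\gamma$-approximate solution for $FPQ_k(P,Q)$ if $\mathrm{dist}(p,Q)\ge\frac1\gamma FPQ_k(P,Q)$. A number $y$ is a $\gamma$-estimation of $x\ge0$ if $x\le y\le\gamma x$. $G(X)=\{Gx:x\in X\}$.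
   Formalization: The bound t = O(log k + d/α²) is proved as t = O(1 + log k + d/α²): for k = 1 and α² much larger than d the literal bound forces t = 0, where (1) fails; for k ≥ 2 the two bounds agree. Also k ≥ 1 is assumed. *)

(* Defs.v *)
From HB Require Import structures.
From mathcomp Require Import all_boot all_order all_algebra.
From mathcomp Require Import all_classical all_reals all_analysis.
Set Implicit Arguments. Unset Strict Implicit. Unset Printing Implicit Defensive.
Import Order.TTheory GRing.Theory Num.Theory.
Local Open Scope ring_scope.

Section FPQ.
Variables (R : realType) (d : nat).

Definition enorm (v : 'rV[R]_d) : R := Num.sqrt (\sum_(i < d) v 0 i ^+ 2).

(* dist(x, Q) = min_{q in Q} ||x - q||  (Q is meant nonempty) *)
Definition dist (x : 'rV[R]_d) (Q : seq 'rV[R]_d) : R :=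
  \big[Num.min/enorm (x - head x Q)]_(q <- Q) enorm (x - q).

Definition FPQ (P Q : seq 'rV[R]_d) : R :=
  \big[Num.max/0]_(p <- P) dist p Q.

Definition approx_sol (gamma : R) (P Q : seq 'rV[R]_d) (p : 'rV[R]_d) : Prop :=
  p \in P /\ dist p Q >= FPQ P Q / gamma.

Definition estimation (gamma x y : R) : Prop := x <= y <= gamma * x.

End FPQ.

Definition imgs (R : realType) (d t : nat) (G : 'M[R]_(d, t)) (X : seq 'rV[R]_d)
  : seq 'rV[R]_t := map (fun x => x *m G) X.

(* Main.v *)
Require Import Defs.
From HB Require Import structures.
From mathcomp Require Import all_boot all_order all_algebra.
From mathcomp Require Import all_classical all_reals all_analysis.
From mathcomp Require Import ring lra.
Import Order.TTheory GRing.Theory Num.Theory.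
Local Open Scope ring_scope.
Local Open Scope classical_set_scope.

(** G is 2 / sqrt t times a random sign matrix. For fixed x, the second and
    fourth moments of a Rademacher sum bound E exp(- <column, x>^2 / 6), so
    |Gx| >= |x| fails with probability at most exp(- t / 23); a union bound over
    the k differences p - q, for p the furthest point, costs the log k.
    The operator norm of the sign matrix is O(sqrt (d + t)) by a union bound over
    integer vectors z in Z^d with |z|^2 <= 4 d (and likewise in Z^t): a bilinear
    form on the balls of radii sqrt d and sqrt t only increases when coordinates
    are rounded to integers following the signs of their coefficients, and there
    are at most 64^d such z. Hence |Gv| = O(alpha) |v| for all v, and (1), (2)
    follow from these two facts deterministically.
    The probability space is nat with the uniform measure on an initial segment,
    on which every set is measurable. *)

(** * Uniform probability on an initial segment of the naturals *)

Section UniformNat.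
Variables (R : realType) (N : nat).

Let scale : {nonneg R} := (N.+1%:R^-1)%:nng.

Definition uniform_nat : set nat -> \bar R :=
  mscale scale (msum (fun i => dirac i : {measure set nat -> \bar R}) N.+1).

HB.instance Definition _ := Measure.on uniform_nat.

Lemma uniform_natE A :
  uniform_nat A = (N.+1%:R^-1 * \sum_(i < N.+1) (`[< A (i : nat) >])%:R)%:E.
Proof.
rewrite /uniform_nat /mscale /msum /= EFinM; congr (_ * _)%E.
rewrite -sumEFin; apply: eq_bigr => i _.
rewrite /= /dirac indicE; congr (_%:R)%:E.
Qed.

Lemma uniform_nat_setT : uniform_nat setT = 1%E.
Proof.
rewrite uniform_natE (eq_bigr (fun=> 1)); last first.
  by move=> i _; rewrite asboolT.
by rewrite sumr_const card_ord mulVf.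
Qed.

HB.instance Definition _ :=
  Measure_isProbability.Build _ _ _ uniform_nat uniform_nat_setT.

End UniformNat.

(** * Averages and probabilities over finite types *)

Definition mean {R : realType} {T : finType} (f : T -> R) : R :=
  (\sum_a f a) / #|T|%:R.

Definition prob {R : realType} {T : finType} (A : pred T) : R :=
  mean (fun a => (A a)%:R).

Section Mean.
Variable R : realType.

Lemma le_mean (T : finType) (f g : T -> R) :
  (forall a, f a <= g a) -> mean f <= mean g.
Proof.
by move=> fg; rewrite ler_wpM2r ?invr_ge0 ?ler0n//; apply: ler_sum => a _.
Qed.

Lemma eq_mean (T : finType) (f g : T -> R) : f =1 g -> mean f = mean g.
Proof. by move=> fg; rewrite /mean (eq_bigr g). Qed.

Lemma mean_ge0 (T : finType) (f : T -> R) : (forall a, 0 <= f a) -> 0 <= mean f.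
Proof. by move=> f0; rewrite mulr_ge0 ?invr_ge0 ?sumr_ge0. Qed.

Lemma meanD (T : finType) (f g : T -> R) :
  mean (fun a => f a + g a) = mean f + mean g.
Proof. by rewrite /mean big_split mulrDl. Qed.

Lemma meanZ (T : finType) (c : R) (f : T -> R) :
  mean (fun a => c * f a) = c * mean f.
Proof. by rewrite /mean -mulr_sumr mulrA. Qed.

Lemma mean_cst (T : finType) (c : R) : (0 < #|T|)%N -> mean (fun _ : T => c) = c.
Proof.
by move=> T0; rewrite /mean sumr_const -[c *+ _]mulr_natr mulfK// pnatr_eq0 -lt0n.
Qed.

Lemma mean_sum (T I : finType) (f : I -> T -> R) :
  mean (fun a => \sum_i f i a) = \sum_i mean (f i).
Proof. by rewrite /mean exchange_big mulr_suml. Qed.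

(** Independence of the coordinates of a uniformly random function; it comes down to distributing a
    product over sums. *)
Lemma mean_prod (T I : finType) (F : I -> T -> R) :
  mean (fun f : {ffun I -> T} => \prod_i F i (f i)) = \prod_i mean (F i).
Proof.
rewrite /mean big_split/= prodr_const bigA_distr_bigA/= card_ffun natrX.
by rewrite exprVn.
Qed.

(** Conditioning on the first sign, which drives the inductions on the length of a Rademacher
    sum. *)
Lemma mean_cons (n : nat) (F : {ffun 'I_n.+1 -> bool} -> R) :
  let cons b (g : {ffun 'I_n -> bool}) :=
    [ffun i => if unlift ord0 i is Some j then g j else b] in
  mean F = mean (fun g => (F (cons true g) + F (cons false g)) / 2).
Proof.
move=> cons; pose h (p : bool * {ffun 'I_n -> bool}) := cons p.1 p.2.
pose h' (f : {ffun 'I_n.+1 -> bool}) := (f ord0, [ffun j => f (lift ord0 j)]).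
have hK : cancel h h'.
  case=> b g; rewrite /h /h' /= !ffunE unlift_none; congr (_, _).
  by apply/ffunP => j; rewrite !ffunE liftK.
have hK' : cancel h' h.
  move=> f; apply/ffunP => i; rewrite !ffunE /=.
  by case: unliftP => [j ->|->]; rewrite ?ffunE.
rewrite /mean !card_ffun !card_ord card_bool -mulr_suml expnS natrM invfM.
rewrite mulrA -[LHS]/(_ / _ / _); congr (_ / _ / _).
rewrite (reindex h); last by exists h' => x _; rewrite ?hK ?hK'.
rewrite -(pair_bigA _ (fun b g => F (cons b g)))/=.
by rewrite big_bool/= big_split.
Qed.

(** Chernoff's method: the indicator of [A] is at most [expR (f a)] pointwise. *)
Lemma markov_exp (T : finType) (A : pred T) (f : T -> R) :
  (forall a, A a -> 0 <= f a) -> prob A <= mean (fun a => expR (f a)).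
Proof.
move=> Af; apply: le_mean => a; have [Aa|_] := boolP (A a); last exact: expR_ge0.
by rewrite (le_trans _ (expR_ge1Dx _))// lerDl Af.
Qed.

End Mean.

(** * Moments of Rademacher sums *)

Definition rad {R : realType} {n : nat} (x : 'I_n -> R)
    (e : {ffun 'I_n -> bool}) : R :=
  \sum_i (-1) ^+ e i * x i.

Section Rademacher.
Variable R : realType.

Lemma rad0 (x : 'I_0 -> R) e : rad x e = 0.
Proof. by rewrite /rad big_ord0. Qed.

Lemma mean_rad_cons (n : nat) (x : 'I_n.+1 -> R) (f : R -> R) :
  mean (fun e => f (rad x e)) =
  mean (fun e => (f (rad (fun i => x (lift ord0 i)) e - x ord0) +
                  f (rad (fun i => x (lift ord0 i)) e + x ord0)) / 2).
Proof.
rewrite mean_cons; apply: eq_mean => e.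
by congr ((f _ + f _) / 2); rewrite /rad big_ord_recl ffunE unlift_none /= ?expr1
   ?expr0 ?mulN1r ?mul1r addrC; congr (_ + _);
   apply: eq_bigr => i _; rewrite ffunE liftK.
Qed.

Lemma card_signs_gt0 (n : nat) : (0 < #|{ffun 'I_n -> bool}|)%N.
Proof. by rewrite card_ffun card_bool expn_gt0. Qed.

Lemma mean_rad_sqr (n : nat) (x : 'I_n -> R) :
  mean (fun e => rad x e ^+ 2) = \sum_i x i ^+ 2.
Proof.
elim: n x => [|n IH] x.
  rewrite big_ord0 (@eq_mean _ _ _ (fun=> 0)) ?mean_cst ?card_signs_gt0// => e.
  by rewrite rad0 expr0n.
rewrite (mean_rad_cons n x (fun s => s ^+ 2)) big_ord_recl -IH.
rewrite -[x ord0 ^+ 2](@mean_cst R _ _ (card_signs_gt0 n)) -meanD.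
by apply: eq_mean => e; field.
Qed.

(** Splitting off a coefficient a, the odd powers cancel: E (S + a)^4 and E (S - a)^4 average to E
    S^4 + 6 a^2 E S^2 + a^4. *)
Lemma mean_rad_pow4 (n : nat) (x : 'I_n -> R) :
  mean (fun e => rad x e ^+ 4) <= 3 * (\sum_i x i ^+ 2) ^+ 2.
Proof.
elim: n x => [|n IH] x.
  rewrite big_ord0 (@eq_mean _ _ _ (fun=> 0)) ?mean_cst ?card_signs_gt0//.
  by move=> e; rewrite rad0 expr0n.
rewrite (mean_rad_cons n x (fun s => s ^+ 4)) big_ord_recl.
set y := fun i => x (lift ord0 i); set a := x ord0.
rewrite (@eq_mean _ _ _ (fun e => rad y e ^+ 4 +
  (6 * a ^+ 2 * rad y e ^+ 2 + a ^+ 4))); last by move=> e; field.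
rewrite !meanD meanZ (mean_rad_sqr n y) mean_cst ?card_signs_gt0//.
have := IH y; set r := \sum_(i < n) _; have : 0 <= r.
  by apply: sumr_ge0 => i _; exact: sqr_ge0.
set m := mean _ => r0 Hm.
have a4 : 0 <= a ^+ 4 by rewrite exprn_even_ge0.
have -> : 3 * (a ^+ 2 + r) ^+ 2 = 3 * r ^+ 2 + 6 * a ^+ 2 * r + 3 * a ^+ 4 by ring.
lra.
Qed.

(** The constant 2, weaker than the sharp 1/2, makes e^v <= 1 / (1 - v) sufficient: for w = u^2 <=
    1/2 the average of the two bounds is 1 / (1 - w) <= 1 + 2 w. For larger u >= 0, already u <= 2
    u^2. *)
Lemma cosh_le (u : R) : (expR u + expR (- u)) / 2 <= expR (2 * u ^+ 2).
Proof.
wlog u0 : u / 0 <= u => [H|].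
  have [/H//|/ltW u0] := leP 0 u.
  by have := H (- u); rewrite oppr_ge0 opprK sqrrN addrC; apply.
have [u2|u2] := leP (2 * u ^+ 2) 1; last first.
  have le1 : expR (- u) <= expR u by rewrite ler_expR; lra.
  apply: (@le_trans _ _ (expR u)); first by lra.
  rewrite ler_expR; nra.
have u1 : u < 1 by nra.
have expR_lt (v : R) : v < 1 -> expR v <= (1 - v)^-1.
  move=> v1; rewrite -[expR v]invrK -expRN lef_pV2 ?posrE ?expR_gt0//; last lra.
  exact: expR_ge1Dx.
have Hp := expR_lt u u1.
have Hn : expR (- u) <= (1 - - u)^-1 by apply: expR_lt; lra.
apply: (le_trans _ (expR_ge1Dx _)).
apply: (@le_trans _ _ ((1 - u ^+ 2)^-1)).
  have -> : (1 - u ^+ 2)^-1 = ((1 - u)^-1 + (1 - - u)^-1) / 2.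
    by field; rewrite !gt_eqF//=; nra.
  lra.
have v1 : 0 < 1 - u ^+ 2 by lra.
rewrite -[leLHS]mul1r ler_pdivrMr//.
by have := sqr_ge0 u; move: (u ^+ 2) u2 v1 => w; nra.
Qed.

Lemma mean_expR_rad (n : nat) (x : 'I_n -> R) :
  mean (fun e => expR (rad x e)) <= expR (2 * \sum_i x i ^+ 2).
Proof.
elim: n x => [|n IH] x.
  rewrite big_ord0 (@eq_mean _ _ _ (fun=> 1)) ?mean_cst ?card_signs_gt0//.
    by rewrite mulr0 expR0.
  by move=> e; rewrite rad0 expR0.
rewrite (mean_rad_cons n x (@expR R)) big_ord_recl.
set y := fun i => x (lift ord0 i); set a := x ord0.
rewrite (@eq_mean _ _ _ (fun e => ((expR a + expR (- a)) / 2) *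
  expR (rad y e))); last by move=> e; rewrite !expRD; ring.
rewrite meanZ mulrDr expRD ler_pM ?IH ?cosh_le//.
by apply: mean_ge0 => e; exact: expR_ge0.
Qed.

(* [e^(-u) <= 1 / (1 + u) <= 1 - u + u^2] at [u = S^2 / 6], so that the second
   and fourth moments of [S] suffice. *)
Lemma mean_expR_sqr_rad (n : nat) (x : 'I_n -> R) : \sum_i x i ^+ 2 = 1 ->
  mean (fun e => expR (- (rad x e ^+ 2 / 6))) <= 11 / 12.
Proof.
move=> x1.
apply: (@le_trans _ _ (mean (fun e => 1 +
    ((- 6^-1) * rad x e ^+ 2 + 36^-1 * rad x e ^+ 4)))).
  apply: le_mean => e; have -> : rad x e ^+ 4 = (rad x e ^+ 2) ^+ 2 by rewrite -exprM.
  have := sqr_ge0 (rad x e); set v := _ ^+ 2 => v0.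
  rewrite expRN; have := expR_ge1Dx (v / 6); set E := expR _ => HE.
  have E0 : 0 < E by lra.
  rewrite -[leLHS]mul1r ler_pdivrMr//.
  apply: (@le_trans _ _ ((1 + ((- 6^-1) * v + 36^-1 * v ^+ 2)) * (1 + v / 6))).
    have -> : (1 + ((- 6^-1) * v + 36^-1 * v ^+ 2)) * (1 + v / 6) = 1 + v ^+ 3 / 216.
      by field.
    by rewrite lerDl divr_ge0// exprn_ge0.
  by rewrite ler_wpM2l//; nra.
(* The moments give 1 - 1/6 + 3/36 = 11/12. *)
rewrite !meanD !meanZ mean_rad_sqr x1 mean_cst ?card_signs_gt0//.
have := mean_rad_pow4 n x; rewrite x1; lra.
Qed.

End Rademacher.

(** * Random sign matrices: lower tail and exponential moments *)

Definition sqn {R : realType} {n : nat} (v : 'rV[R]_n) : R :=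
  \sum_i v 0 i ^+ 2.

Definition signmx {R : realType} {d t : nat}
    (w : {ffun 'I_t -> {ffun 'I_d -> bool}}) : 'M[R]_(d, t) :=
  \matrix_(i, j) (-1) ^+ (w j i).

Section SignMatrix.
Variables (R : realType) (d t : nat).
Implicit Types (x : 'rV[R]_d) (w : {ffun 'I_t -> {ffun 'I_d -> bool}}).

Lemma sqn_ge0 n (v : 'rV[R]_n) : 0 <= sqn v.
Proof. by apply: sumr_ge0 => i _; exact: sqr_ge0. Qed.

Lemma sqnZ n (c : R) (v : 'rV[R]_n) : sqn (c *: v) = c ^+ 2 * sqn v.
Proof. by rewrite /sqn mulr_sumr; apply: eq_bigr => i _; rewrite mxE exprMn. Qed.

Lemma sqn_eq0 n (v : 'rV[R]_n) : sqn v = 0 -> v = 0.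
Proof.
move=> v0; apply/rowP => i; rewrite mxE; apply/eqP; rewrite -sqrf_eq0.
by rewrite (psumr_eq0P _ v0)// => j _; exact: sqr_ge0.
Qed.

Lemma mul_signmx x w j : (x *m signmx w) 0 j = rad (x 0) (w j).
Proof. by rewrite mxE; apply: eq_bigr => i _; rewrite mxE mulrC. Qed.

Lemma signmx_lower_tail x :
  prob (fun w : {ffun 'I_t -> {ffun 'I_d -> bool}} =>
      sqn (x *m signmx w) < t%:R / 4 * sqn x) <= expR (- (t%:R / 23)) :> R.
Proof.
have [x0|xn0] := eqVneq (sqn x) 0.
  rewrite /prob (@eq_mean _ _ _ (fun w => 0 * 0)) ?meanZ ?mul0r ?expR_ge0// => w.
  by rewrite x0 !mulr0 ltNge sqn_ge0.
have x0 : 0 < sqn x by rewrite lt_neqAle eq_sym xn0 sqn_ge0.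
set c := Num.sqrt (sqn x); have c2 : c ^+ 2 = sqn x by rewrite sqr_sqrtr// ltW.
have cn0 : c != 0 by rewrite sqrtr_eq0 -ltNge.
have [y xy y1] : exists2 y, x = c *: y & sqn y = 1.
  exists (c^-1 *: x); first by rewrite scalerA divff// scale1r.
  by rewrite sqnZ exprVn c2 mulVf.
(* On the event, the squared entries of the image of the unit vector [y] sum to less than t / 4;
   dividing by 6 yields 1/24 per column and [f w] >= 0. *)
pose f w : R := \sum_(j < t) (24^-1 - rad (y 0) (w j) ^+ 2 / 6).
apply: (le_trans (@markov_exp _ _ _ f _)) => [w|].
  rewrite xy -scalemxAl !sqnZ y1 mulr1 mulrC ltr_pM2r ?c2//.
  rewrite /f sumrB sumr_const card_ord -mulr_suml.
  rewrite /sqn; under eq_bigr do rewrite mul_signmx.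
  rewrite -[_ *+ _]mulr_natr; lra.
rewrite (@eq_mean _ _ _ (fun w => \prod_j expR (24^-1 - rad (y 0) (w j) ^+ 2 / 6)));
  last by move=> w; rewrite expR_sum.
rewrite (@mean_prod R _ _ (fun _ e => expR (24^-1 - rad (y 0) e ^+ 2 / 6))).
rewrite prodr_const card_ord.
have -> : - (t%:R / 23) = t%:R * (- 23^-1) :> R by rewrite mulrN.
rewrite mulrC expRM_natr lerXn2r ?nnegrE ?expR_ge0//.
  by apply: mean_ge0 => e; exact: expR_ge0.
rewrite (@eq_mean _ _ _ (fun e => expR 24^-1 *
  expR (- (rad (y 0) e ^+ 2 / 6)))); last by move=> e; rewrite expRD.
rewrite meanZ.
(* Each column contributes at most e^(1/24) * 11/12 <= (24/23) * (11/12) = 1 - 1/23 <= e^(-1/23). *)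
have H1 := mean_expR_sqr_rad R d (y 0) y1.
have H2 := expR_ge1Dx (- 23^-1 : R).
have H3 := expR_ge1Dx (- 24^-1 : R); rewrite expRN in H3.
have E0 := expR_gt0 (24^-1 : R).
have E1 : expR (24^-1 : R) <= 24 / 23.
  rewrite -[leLHS]invrK -[leRHS]invrK lef_pV2 ?posrE ?invr_gt0//; lra.
have M0 : 0 <= mean (fun e => expR (- (rad (y 0) e ^+ 2 / 6))).
  by apply: mean_ge0 => e; exact: expR_ge0.
nra.
Qed.

(** The columns are independent, so the mean factors into Rademacher exponentials with coefficients
    s * b_j * a_i. *)
Lemma mean_expR_bilinear (a : 'I_d -> R) (b : 'I_t -> R) (s : R) :
  mean (fun w => expR (s * \sum_j b j * rad a (w j)))
    <= expR (2 * s ^+ 2 * (\sum_i a i ^+ 2) * (\sum_j b j ^+ 2)).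
Proof.
rewrite (@eq_mean _ _ _ (fun w =>
  \prod_j expR (rad (fun i => s * b j * a i) (w j)))); last first.
  move=> w; rewrite -expR_sum mulr_sumr; congr expR; apply: eq_bigr => j _.
  by rewrite mulrA mulr_sumr; apply: eq_bigr => i _; rewrite mulrCA.
rewrite (@mean_prod R _ _ (fun j e => expR (rad (fun i => s * b j * a i) e))).
rewrite mulr_sumr expR_sum; apply: ler_prod => j _; apply/andP; split.
  by apply: mean_ge0 => e; exact: expR_ge0.
apply: (le_trans (mean_expR_rad _ _ _)); rewrite ler_expR.
under eq_bigr do rewrite exprMn.
by rewrite -mulr_sumr exprMn le_eqVlt; apply/orP; left; apply/eqP; ring.
Qed.

End SignMatrix.

(* Integer vectors are encoded by signs and magnitudes: a zero coordinate has two
   codes, which is harmless since only upper bounds on their number are used. *)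
Definition netval {R : realType} {B n : nat}
    (z : {ffun 'I_n -> bool * 'I_B.+2}) (i : 'I_n) : R :=
  (-1) ^+ (z i).1 * ((z i).2 : nat)%:R.

Definition innet {B n : nat} (z : {ffun 'I_n -> bool * 'I_B.+2}) : bool :=
  (\sum_i (z i).2 ^ 2 <= 4 * n)%N.

(** * Integer nets: cardinality and rounding *)

Section Net.
Variables (R : realType) (B : nat).

Lemma innet_sqr n (z : {ffun 'I_n -> bool * 'I_B.+2}) :
  innet z -> \sum_i netval z i ^+ 2 <= 4 * n%:R :> R.
Proof.
rewrite /innet -(ler_nat R) natrM natr_sum; apply: le_trans.
by apply: ler_sum => i _; rewrite exprMn sqrr_sign mul1r natrX.
Qed.

Lemma geometric_half_le m : \sum_(i < m) (2^-1 : R) ^+ i <= 2.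
Proof.
suff -> : \sum_(i < m) (2^-1 : R) ^+ i = 2 - 2 * 2^-1 ^+ m.
  by rewrite gerBl mulr_ge0// exprn_ge0// invr_ge0.
elim: m => [|m IH]; first by rewrite big_ord0 expr0; ring.
by rewrite big_ord_recr/= IH exprS; field.
Qed.

(** The weight 16^n * 2^(- |z|^2) is at least 1 on the net, since |z|^2 <= 4 n. It factors over
    coordinates; each coordinate sums to at most 4 (two signs, and 2^(- m^2) <= 2^(- m)), whence 16
    * 4 = 64. *)
Lemma card_innet_le n :
  \sum_(z : {ffun 'I_n -> bool * 'I_B.+2}) (innet z)%:R <= (64 : R) ^+ n.
Proof.
pose g (p : bool * 'I_B.+2) : R := 2^-1 ^+ (p.2 ^ 2).
apply: (@le_trans _ _ (\sum_(z : {ffun 'I_n -> bool * 'I_B.+2})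
    (16 : R) ^+ n * \prod_i g (z i))).
  apply: ler_sum => z _.
  have g0 i : 0 < g (z i) by rewrite exprn_gt0// invr_gt0.
  have P0 : 0 < \prod_i g (z i) by apply: prodr_gt0 => i _.
  case: (boolP (innet z)) => Hz; last by rewrite mulr_ge0 ?ltW// exprn_ge0.
  rewrite /g prodrXr exprVn -ler_pdivrMr ?invr_gt0 ?exprn_gt0// div1r invrK.
  have -> : (16 : R) = 2 ^+ 4 by rewrite -natrX.
  by rewrite -exprM ler_eXn2l// ltr1n.
rewrite -mulr_sumr -(bigA_distr_bigA (fun _ => g))/= prodr_const card_ord -exprMn.
rewrite lerXn2r ?nnegrE//.
  by rewrite mulr_ge0// sumr_ge0// => p _; rewrite exprn_ge0// invr_ge0.
rewrite -(pair_bigA _ (fun b m => g (b, m)))/= big_bool/=.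
suff : \sum_(m < B.+2) g (true, m) <= 2.
  by rewrite /g/=; lra.
apply: le_trans (geometric_half_le B.+2); apply: ler_sum => i _.
rewrite /g/= ler_wiXn2l ?invr_ge0 ?invf_le1 ?ler1n//.
by case: (i : nat) => // m; rewrite expnS expn1 leq_pmulr.
Qed.

(* Each coordinate is moved away from [0] in the direction of the sign of its
   coefficient, which can only increase the linear form. *)
Lemma innet_round n (c x : 'I_n -> R) : (n <= B)%N -> \sum_i x i ^+ 2 <= n%:R ->
  exists2 z : {ffun 'I_n -> bool * 'I_B.+2}, innet z &
    \sum_i c i * x i <= \sum_i c i * netval z i.
Proof.
move=> nB xn; pose m i := (Num.truncn `|x i|).+1.
have m_gt i : `|x i| < (m i)%:R.
  by have /andP[] := truncn_itv (normr_ge0 (x i)).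
have m_le i : (m i)%:R <= `|x i| + 1.
  by have /andP[+ _] := truncn_itv (normr_ge0 (x i)); rewrite /m -natr1 lerD2r.
(* Summed over i, this bound on (|x_i| + 1)^2 gives 2 n + 2 n, the 4 n in [innet]. *)
have m2 i : ((m i) ^ 2)%:R <= 2 * x i ^+ 2 + 2.
  rewrite natrX -[x i ^+ 2]real_normK ?num_real//.
  apply: (@le_trans _ _ ((`|x i| + 1) ^+ 2)).
    by rewrite lerXn2r ?nnegrE ?addr_ge0.
  by have := sqr_ge0 (`|x i| - 1); rewrite !expr2; lra.
(* From x_i^2 <= n <= n^2 the truncation is at most n <= B, so the magnitude fits in ['I_B.+2]. *)
have mB i : (m i < B.+2)%N.
  rewrite ltnS /m ltnS.
  have : x i ^+ 2 <= n%:R.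
    apply: le_trans xn; rewrite (bigD1 i)//= lerDl.
    by apply: sumr_ge0 => j _; exact: sqr_ge0.
  move=> xin; apply: leq_trans nB; rewrite -(ler_nat R).
  have /andP[tx _] := truncn_itv (normr_ge0 (x i)).
  apply: (le_trans tx).
  rewrite -(ler_sqr (x := `|x i|)) ?nnegrE// real_normK ?num_real//.
  apply: (le_trans xin); rewrite -natrX ler_nat.
  by case: (n) => // k; rewrite expnS expn1 leq_pmulr.
pose z : {ffun 'I_n -> bool * 'I_B.+2} := [ffun i => (c i < 0, inord (m i))].
exists z.
  rewrite /innet -(ler_nat R) natr_sum natrM.
  apply: (@le_trans _ _ (\sum_i (2 * x i ^+ 2 + 2))).
    by apply: ler_sum => i _; rewrite ffunE/= inordK.
  rewrite big_split/= -mulr_sumr sumr_const card_ord -[2 *+ n]mulr_natr; lra.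
apply: ler_sum => i _; rewrite /netval ffunE/= inordK//.
rewrite mulrA.
have -> : c i * (-1) ^+ (c i < 0)%R = `|c i|.
  by rewrite [RHS]normrEsign mulrC.
by rewrite (le_trans (ler_norm _))// normrM ler_wpM2l// ltW.
Qed.

End Net.

(** * Operator norm of a sign matrix *)

Section OperatorNorm.
Variables (R : realType) (d t : nat).
Hypotheses (d0 : (0 < d)%N) (t0 : (0 < t)%N).
Implicit Types (x : 'rV[R]_d) (w : {ffun 'I_t -> {ffun 'I_d -> bool}}).

Let B := (d + t)%N.
(* With this [s] the exponent [2 * s^2 * (4 d) * (4 t)] of the Chernoff bound on
   the net is [32 * (d + t)]. *)
Let s : R := Num.sqrt ((d + t)%:R / (d * t)%:R).

Let s_gt0 : 0 < s.
Proof. by rewrite sqrtr_gt0 divr_gt0 ?ltr0n ?addn_gt0 ?muln_gt0 ?d0 ?t0. Qed.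

Let s_sqr : s ^+ 2 * (d%:R * t%:R) = d%:R + t%:R.
Proof.
rewrite sqr_sqrtr ?divr_ge0// -natrM -natrD divfK//.
by rewrite pnatr_eq0 -lt0n muln_gt0 d0.
Qed.

(** The threshold 84 leaves a margin of 52 over the moment exponent 32 * (d + t), enough to pay for
    the number of net pairs. *)
Let net_large w (z : {ffun 'I_d -> bool * 'I_B.+2} * {ffun 'I_t -> bool * 'I_B.+2}) :=
  84 * (d%:R + t%:R) <
    s * \sum_j netval z.2 j * rad (netval z.1) (w j).

(** The image v of x is tested against itself: the bilinear form at (x, v) is |v|^2, and rescaling
    followed by rounding turns a large value into one on the net. *)
Lemma signmx_opnorm_net w x :
  84 ^+ 2 * (d%:R + t%:R) * sqn x < sqn (x *m signmx w) ->
  exists z, [&& innet z.1, innet z.2 & net_large w z].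
Proof.
set v := x *m _; set a := sqn x; set b := sqn v => ab.
have a0 : 0 <= a by exact: sqn_ge0.
have b0 : 0 < b by apply: le_lt_trans ab; rewrite !mulr_ge0// addr_ge0.
have {}a0 : 0 < a.
  rewrite lt_neqAle a0 andbT eq_sym; apply/eqP => /sqn_eq0 x0.
  move: b0; rewrite /b /v x0 mul0mx /sqn big1 ?ltxx// => i _.
  by rewrite mxE expr0n.
(* These factors put x and v on the spheres of radii sqrt d and sqrt t. *)
pose p := Num.sqrt (d%:R / a); pose q := Num.sqrt (t%:R / b).
have p2 : p ^+ 2 = d%:R / a by rewrite sqr_sqrtr// divr_ge0// ltW.
have q2 : q ^+ 2 = t%:R / b by rewrite sqr_sqrtr// divr_ge0// ltW.
have xN : \sum_i (p *: x) 0 i ^+ 2 <= d%:R.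
  by rewrite -[leLHS]/(sqn (p *: x)) sqnZ p2 divfK// gt_eqF.
have vN : \sum_i (q *: v) 0 i ^+ 2 <= t%:R.
  by rewrite -[leLHS]/(sqn (q *: v)) sqnZ q2 divfK// gt_eqF.
(* Rounding is done one side at a time: first x against the exact v, then v against the rounded
   x. *)
have [z zN zle] := innet_round R B d
  (fun i => \sum_j (q *: v) 0 j * (-1) ^+ w j i) _ (leq_addr t d) xN.
have [z' zN' zle'] := innet_round R B t
  (fun j => rad (netval z) (w j)) _ (leq_addl d t) vN.
exists (z, z'); rewrite /= zN zN'/= /net_large/=.
have pqb : p * q * b <= \sum_j netval z' j * rad (netval z) (w j).
  apply: (@le_trans _ _ (\sum_j rad (netval z) (w j) * (q *: v) 0 j)).
    apply: (@le_trans _ _ (\sum_i (\sum_j (q *: v) 0 j * (-1) ^+ w j i) * (p *: x) 0 i)).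
      rewrite le_eqVlt; apply/orP; left; apply/eqP.
      under [RHS]eq_bigr do rewrite mulr_suml.
      rewrite exchange_big/= /b /sqn mulr_sumr; apply: eq_bigr => j _.
      rewrite expr2 {1}mul_signmx /rad mulr_suml mulr_sumr.
      by apply: eq_bigr => i _; rewrite !mxE; ring.
    apply: (le_trans zle); rewrite le_eqVlt; apply/orP; left; apply/eqP.
    under eq_bigr do rewrite mulr_suml.
    rewrite exchange_big/=; apply: eq_bigr => j _.
    by rewrite /rad mulr_suml; apply: eq_bigr => i _; ring.
  by apply: (le_trans zle'); apply: ler_sum => j _; rewrite mulrC.
apply: (@lt_le_trans _ _ (s * (p * q * b))); last by rewrite ler_wpM2l// ltW.
have D0 : 0 <= d%:R + t%:R :> R by rewrite addr_ge0.
(* Squares are compared: by the choice of [s], [p] and [q], the right side becomes (d + t) * b /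
   a. *)
rewrite -(ltr_pXn2r (n := 2))// ?nnegrE ?mulr_ge0 ?sqrtr_ge0// ?(ltW b0)//.
rewrite !exprMn p2 q2.
have -> : s ^+ 2 * (d%:R / a * (t%:R / b) * b ^+ 2) = (d%:R + t%:R) * (b / a).
  by rewrite -s_sqr; field; rewrite !gt_eqF.
rewrite (_ : 84 ^+ 2 * (d%:R + t%:R) ^+ 2 =
  (d%:R + t%:R) * (84 ^+ 2 * (d%:R + t%:R))); last by ring.
rewrite ltr_pM2l; last by rewrite -natrD ltr0n addn_gt0 d0.
by rewrite ltr_pdivlMr.
Qed.

Lemma signmx_opnorm_tail :
  prob (fun w : {ffun 'I_t -> {ffun 'I_d -> bool}} =>
    `[< exists x : 'rV[R]_d, 84 ^+ 2 * (d%:R + t%:R) * sqn x <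
    sqn (x *m signmx w) >]) <= 6^-1 :> R.
Proof.
pose D : R := d%:R + t%:R; have D1 : 1 <= D.
  by rewrite /D -natrD ler1n addn_gt0 d0.
(* [K] is the indicator of the net pairs, so that the union bound is a sum over the whole finite
   type. *)
pose K (z : {ffun 'I_d -> bool * 'I_B.+2} * {ffun 'I_t -> bool * 'I_B.+2}) : R :=
  (innet z.1)%:R * (innet z.2)%:R.
have K0 z : 0 <= K z by rewrite mulr_ge0.
apply: (@le_trans _ _ (mean (fun w => \sum_z K z *
    expR (s * \sum_j netval z.2 j * rad (netval z.1) (w j)
          - 84 * D)))).
  apply: le_mean => w; case: asboolP => [[x Hx]|_]; last first.
    by apply: sumr_ge0 => z _; rewrite mulr_ge0 ?expR_ge0.
  have [z /and3P[z1 z2 Hz]] := signmx_opnorm_net w x Hx.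
  rewrite (bigD1 z)//= /K z1 z2 !mul1r; apply: ler_wpDr.
    by apply: sumr_ge0 => z' _; rewrite mulr_ge0 ?expR_ge0.
  rewrite (le_trans _ (expR_ge1Dx _))// lerDl subr_ge0 ltW//.
rewrite mean_sum.
apply: (@le_trans _ _ (\sum_z K z * expR (- (52 * D)))).
  apply: ler_sum => z _; rewrite meanZ /K.
  have [z1|_] := boolP (innet z.1); last by rewrite !mul0r.
  have [z2|_] := boolP (innet z.2); last by rewrite mulr0 !mul0r.
  rewrite !mul1r.
  rewrite (@eq_mean _ _ _ (fun w => expR (- (84 * D)) *
    expR (s * \sum_j netval z.2 j * rad (netval z.1) (w j)))); last first.
    by move=> w; rewrite expRD mulrC.
  rewrite meanZ.
  have -> : - (52 * D) = - (84 * D) + 32 * D by ring.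
  rewrite expRD ler_wpM2l ?expR_ge0// (le_trans (mean_expR_bilinear _ _ _ _ _ _))//.
  rewrite ler_expR /D -s_sqr.
  have := innet_sqr R B t _ z2; have := innet_sqr R B d _ z1.
  set n1 := \sum_i _; set n2 := \sum_i _ => h1 h2.
  have n20 : 0 <= n2 by apply: sumr_ge0 => i _; exact: sqr_ge0.
  have n10 : 0 <= n1 by apply: sumr_ge0 => i _; exact: sqr_ge0.
  have -> : 32 * (s ^+ 2 * (d%:R * t%:R)) = 2 * s ^+ 2 * (4 * d%:R * (4 * t%:R)) by ring.
  rewrite -[_ * n1 * n2]mulrA; apply: ler_wpM2l; first by rewrite mulr_ge0 ?sqr_ge0.
  exact: ler_pM.
rewrite -mulr_suml /K -(pair_bigA _ (fun z1 z2 => (innet z1)%:R * (innet z2)%:R))/=.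
under eq_bigr do rewrite -mulr_sumr.
rewrite -mulr_suml.
have e1 : 2 <= expR 1 :> R by exact: (le_trans _ (expR_ge1Dx _)).
have e64 : 64 <= expR 6 :> R.
  have -> : 6 = 1 * 6%:R :> R by rewrite mul1r.
  rewrite expRM_natr; apply: (@le_trans _ _ (2 ^+ 6)); first by rewrite -natrX.
  by rewrite lerXn2r ?nnegrE ?expR_ge0.
(* There are at most 64^(d + t) net pairs, and 64 = 2^6 <= e^6. What remains is e^(-46 D) <= e^(-5)
   <= 1/6. *)
apply: (@le_trans _ _ (expR (6 * D) * expR (- (52 * D)))).
  rewrite ler_wpM2r ?expR_ge0// /D mulrDr expRD !expRM_natr.
  rewrite ler_pM ?sumr_ge0//; apply: (le_trans (card_innet_le _ _ _));
    by rewrite lerXn2r ?nnegrE ?expR_ge0.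
rewrite -expRD; apply: (@le_trans _ _ (expR (- 5))).
  by rewrite ler_expR; lra.
rewrite expRN lef_pV2 ?posrE ?expR_gt0//.
by apply: le_trans (expR_ge1Dx _); lra.
Qed.

End OperatorNorm.

(** Transports a finite average to [nat] through the enumeration of [T]; [uniform_nat R N] lives on
    N + 1 points, hence the predecessor. *)
Lemma uniform_nat_mean (R : realType) (T : finType) (a0 : T) (A : set T) :
  uniform_nat R #|T|.-1 [set i | A (nth a0 (enum T) i)] =
  (mean (fun a => (`[< A a >])%:R))%:E.
Proof.
have T0 : (0 < #|T|)%N by apply/card_gt0P; exists a0.
rewrite uniform_natE prednK// /mean mulrC; congr (_ / _)%:E.
by rewrite -[RHS]big_enum (big_nth a0) big_mkord -cardE.
Qed.

(** * Furthest point queries under a linear map *)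

Section FurthestPoint.
Variable R : realType.

Lemma enorm_ge0 d (v : 'rV[R]_d) : 0 <= enorm v.
Proof. exact: sqrtr_ge0. Qed.

Lemma dist_le d (x : 'rV[R]_d) Q q : q \in Q -> dist x Q <= enorm (x - q).
Proof.
rewrite /dist; move: (enorm (x - head x Q)) => e.
elim: Q => // a Q IH; rewrite inE big_cons ge_min => /orP[/eqP->|/IH ->].
  by rewrite lexx.
by rewrite orbT.
Qed.

Lemma dist_attained d (x : 'rV[R]_d) Q : (0 < size Q)%N ->
  exists2 q, q \in Q & dist x Q = enorm (x - q).
Proof.
case: Q => // a Q _; rewrite /dist/=.
(* The minimum is seeded with the distance to the head [a]; keeping the seed fixed and adding [a] to
   the candidates lets the induction vary the list. *)
suff [q qQ ->] : exists2 q, q \in a :: (a :: Q) &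
    \big[Num.min/enorm (x - a)]_(q <- a :: Q) enorm (x - q) = enorm (x - q).
  by exists q => //; move: qQ; rewrite !inE orbA orbb.
elim: (a :: Q) => [|b s [q qs IH]]; first by exists a; rewrite ?big_nil ?mem_head.
rewrite big_cons IH minElt; case: ifP => _; first by exists b; rewrite // !inE eqxx orbT.
by exists q => //; move: qs; rewrite !inE => /orP[->//|->]; rewrite !orbT.
Qed.

Lemma dist_ge0 d (x : 'rV[R]_d) Q : (0 < size Q)%N -> 0 <= dist x Q.
Proof. by move=> /(dist_attained _ x)[q _ ->]; exact: enorm_ge0. Qed.

Lemma FPQ_ge d (P Q : seq 'rV[R]_d) p : p \in P -> dist p Q <= FPQ P Q.
Proof.
rewrite /FPQ; elim: P => // a P IH; rewrite inE big_cons le_max.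
by move=> /orP[/eqP->|/IH ->]; rewrite ?lexx ?orbT.
Qed.

Lemma FPQ_attained d (P Q : seq 'rV[R]_d) : (0 < size P)%N -> (0 < size Q)%N ->
  exists2 p, p \in P & FPQ P Q = dist p Q.
Proof.
move=> + Q0; rewrite /FPQ; elim: P => // a P IH _; rewrite big_cons.
have [P0|] := posnP (size P).
  (* The empty maximum is 0, so the nonnegativity of distances is what makes a single point attain
     it. *)
  by exists a; rewrite ?mem_head// (size0nil P0) big_nil max_l// dist_ge0.
move=> /IH[p pP ->]; rewrite maxElt; case: ifP => _; last by exists a; rewrite ?mem_head.
by exists p => //; rewrite inE pP orbT.
Qed.

Lemma mem_imgs d t (G : 'M[R]_(d, t)) x X : x \in X -> x *m G \in imgs G X.
Proof. exact: (map_f (fun x => x *m G)). Qed.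

Lemma dist_imgs_le d t (G : 'M[R]_(d, t)) (M : R) x Q :
  (0 < size Q)%N -> (forall v, enorm (v *m G) <= M * enorm v) ->
  dist (x *m G) (imgs G Q) <= M * dist x Q.
Proof.
move=> /(dist_attained _ x)[q qQ ->] hM; apply: le_trans (hM (x - q)).
by rewrite mulmxBl dist_le// mem_imgs.
Qed.

(** Only differences from the furthest point p must not shrink, giving FPQ(P,Q) <= FPQ(GP,GQ). For
    (2) this is continued by FPQ(GP,GQ) <= beta * dist(Gr,GQ) <= beta * M * dist(r,Q). *)
Lemma furthest_point_preserved d t (G : 'M[R]_(d, t)) (M beta C : R) P Q p :
  (0 < size Q)%N -> p \in P -> FPQ P Q = dist p Q ->
  (forall v, enorm (v *m G) <= M * enorm v) ->
  {in Q, forall q, enorm (p - q) <= enorm ((p - q) *m G)} ->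
  1 <= beta -> 0 < M -> beta * M <= C ->
  estimation C (FPQ P Q) (FPQ (imgs G P) (imgs G Q)) /\
  (forall p', p' \in P -> approx_sol beta (imgs G P) (imgs G Q) (p' *m G) ->
     approx_sol C P Q p').
Proof.
move=> Q0 pP pE hM hp beta1 M0 MC.
have F0 : 0 <= FPQ P Q by rewrite pE dist_ge0.
have C0 : 0 < C by nra.
have lo : FPQ P Q <= FPQ (imgs G P) (imgs G Q).
  apply: (le_trans _ (FPQ_ge _ _ _ (p *m G) _)); last exact: mem_imgs.
  have [|q' /mapP[q qQ ->] ->] := dist_attained _ (p *m G) (imgs G Q).
    by rewrite size_map.
  by rewrite -mulmxBl pE (le_trans _ (hp q qQ))// dist_le.
split; first (apply/andP; split => //).
  have [||p' /mapP[r rP ->] ->] := FPQ_attained _ (imgs G P) (imgs G Q).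
  - by rewrite size_map; case: (P) pP.
  - by rewrite size_map.
  have H1 := dist_imgs_le _ _ G M r Q Q0 hM; have H2 := FPQ_ge _ P Q r rP.
  by rewrite (le_trans H1)// ler_pM ?dist_ge0 ?(ltW M0)//; nra.
move=> r rP [_ H]; split => //.
have H1 := dist_imgs_le _ _ G M r Q Q0 hM.
rewrite ler_pdivrMr; last lra.
rewrite ler_pdivrMr in H; last lra.
apply: (le_trans lo); apply: (le_trans H).
apply: (@le_trans _ _ (M * dist r Q * beta)).
  by rewrite ler_wpM2r//; lra.
by rewrite mulrAC mulrC ler_wpM2l ?dist_ge0// mulrC.
Qed.

End FurthestPoint.

(** * Joint success probability and the scaling by 2 / sqrt t *)

Section SignMatrixEvents.
Variables (R : realType) (d t : nat).
Implicit Types w : {ffun 'I_t -> {ffun 'I_d -> bool}}.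

Lemma signmx_good_prob (X : seq 'rV[R]_d) : (0 < d)%N -> (0 < t)%N ->
  5 / 6 - (size X)%:R * expR (- (t%:R / 23)) <=
  prob (fun w : {ffun 'I_t -> {ffun 'I_d -> bool}} =>
    `[< (forall x : 'rV[R]_d, sqn (x *m signmx w) <=
           84 ^+ 2 * (d%:R + t%:R) * sqn x) /\
        {in X, forall x, t%:R / 4 * sqn x <= sqn (x *m signmx w)} >]) :> R.
Proof.
move=> d0 t0; set good := fun w => _.
pose low (x : 'rV[R]_d) (w : {ffun 'I_t -> {ffun 'I_d -> bool}}) : R :=
  (sqn (x *m signmx w) < t%:R / 4 * sqn x)%R%:R.
pose big (w : {ffun 'I_t -> {ffun 'I_d -> bool}}) : R :=
  (`[< exists x : 'rV[R]_d, 84 ^+ 2 * (d%:R + t%:R) * sqn x <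
    sqn (x *m signmx w) >])%:R.
have low0 x w : 0 <= low x w by [].
(* Union bound as a pointwise inequality of indicators: a matrix that is not good stretches some
   vector too much or shrinks a member of [X]. *)
have cover w : 1 <= (good w)%:R + (big w + \sum_(i < size X) low X`_i w).
  have sum0 : 0 <= \sum_(i < size X) low X`_i w by apply: sumr_ge0.
  rewrite /big; case: asboolP => [_|Hbig].
    by rewrite mulr1n; have : 0 <= (good w)%:R :> R by []; lra.
  rewrite /good; case: asboolP => [_|Hgood].
    by rewrite mulr1n mulr0n; lra.
  rewrite !mulr0n !add0r.
  have [x xX Hx] : exists2 x, x \in X &
      sqn (x *m signmx w) < t%:R / 4 * sqn x.
    apply: contrapT => H; apply: Hgood; split=> x => [|xX].
      by rewrite leNgt; apply/negP => Hx; apply: Hbig; exists x.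
    by rewrite leNgt; apply/negP => Hx; apply: H; exists x.
  have iX : (index x X < size X)%N by rewrite index_mem.
  rewrite (bigD1 (Ordinal iX))//= nth_index// /low Hx mulr1n lerDl.
  by apply: sumr_ge0.
have W0 : (0 < #|{ffun 'I_t -> {ffun 'I_d -> bool}}|)%N.
  by rewrite card_ffun expn_gt0 card_signs_gt0.
have := le_mean R _ _ _ cover.
rewrite mean_cst// !meanD mean_sum => H.
have H1 : mean big <= 6^-1 by exact: signmx_opnorm_tail.
have H2 : \sum_(i < size X) mean (low X`_i) <= (size X)%:R * expR (- (t%:R / 23)).
  rewrite -[size X in leRHS]card_ord mulr_natl -sumr_const.
  by apply: ler_sum => i _; exact: signmx_lower_tail.
rewrite /prob; lra.
Qed.

Lemma scaled_signmx_enorm w (x : 'rV[R]_d) :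
  enorm (x *m ((2 / Num.sqrt t%:R) *: signmx w)) =
  2 / Num.sqrt t%:R * Num.sqrt (sqn (x *m signmx w)).
Proof.
have c0 : 0 <= 2 / Num.sqrt t%:R :> R by rewrite divr_ge0 ?sqrtr_ge0.
rewrite -scalemxAr -[LHS]/(Num.sqrt (@sqn R t _)) sqnZ sqrtrM ?sqr_ge0//.
by rewrite sqrtr_sqr ger0_norm.
Qed.

Lemma scaled_signmx_ge w (x : 'rV[R]_d) : (0 < t)%N ->
  t%:R / 4 * sqn x <= sqn (x *m signmx w) ->
  enorm x <= enorm (x *m ((2 / Num.sqrt t%:R) *: signmx w)).
Proof.
move=> t0 H; rewrite scaled_signmx_enorm -[enorm x]/(Num.sqrt (sqn x)).
have c0 : 0 < Num.sqrt t%:R :> R by rewrite sqrtr_gt0 ltr0n.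
rewrite mulrAC ler_pdivlMr// -[2]ger0_norm// -sqrtr_sqr -!sqrtrM ?sqr_ge0 ?sqn_ge0//.
by apply: ler_wsqrtr; lra.
Qed.

(** The hypothesis d <= a^2 t gives d + t <= 2 a^2 t <= 4 a^2 t, which makes the radicand (168 a)^2
    * t * |x|^2; the scale 2 / sqrt t then gives 336 a. *)
Lemma scaled_signmx_le w (x : 'rV[R]_d) (a : R) : (0 < t)%N -> 1 <= a ->
  d%:R / a ^+ 2 <= t%:R ->
  sqn (x *m signmx w) <= 84 ^+ 2 * (d%:R + t%:R) * sqn x ->
  enorm (x *m ((2 / Num.sqrt t%:R) *: signmx w)) <= 336 * a * enorm x.
Proof.
move=> t0 a1 dt H; rewrite scaled_signmx_enorm -[enorm x]/(Num.sqrt (sqn x)).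
have c0 : 0 < Num.sqrt t%:R :> R by rewrite sqrtr_gt0 ltr0n.
have a0 : 0 < a by lra.
have x0 := sqn_ge0 R d x.
rewrite mulrAC ler_pdivrMr//.
have -> : 336 * a * Num.sqrt (sqn x) * Num.sqrt t%:R =
    2 * Num.sqrt ((168 * a) ^+ 2 * (sqn x * t%:R)).
  rewrite sqrtrM ?sqr_ge0// sqrtr_sqr ger0_norm ?mulr_ge0 ?(ltW a0)//.
  by rewrite sqrtrM//; ring.
rewrite ler_wpM2l//; apply: ler_wsqrtr; apply: (le_trans H).
rewrite ler_pdivrMr ?exprn_gt0// in dt.
have t1 : 0 < t%:R :> R by rewrite ltr0n.
have a2 : 1 <= a ^+ 2 by rewrite exprn_ege1.
have dt2 : d%:R + t%:R <= 2 * a ^+ 2 * t%:R by nra.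
have -> : (168 * a) ^+ 2 * (sqn x * t%:R) =
  84 ^+ 2 * (4 * a ^+ 2 * t%:R) * sqn x by ring.
by rewrite ler_wpM2r// ler_wpM2l//; nra.
Qed.

End SignMatrixEvents.

(** * Choice of the dimension and conclusion *)

Theorem theoremC1 (R : realType) (beta : R) (hbeta : 1 <= beta) :
  exists C : R, 0 < C /\
  forall (d k n : nat) (alpha : R),
    (1 < d)%N -> 1 < alpha -> (1 <= k)%N -> (k <= n)%N ->
    exists (t : nat) (dsp : measure_display) (Omega : measurableType dsp)
           (Pr : probability Omega R) (G : Omega -> 'M[R]_(d, t)),
      t%:R <= C * (1 + ln k%:R + d%:R / alpha ^+ 2) /\
      forall P Q : seq 'rV[R]_d,
        uniq P -> size P = n -> uniq Q -> size Q = k ->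
        let good := [set w : Omega |
          estimation (C * alpha) (FPQ P Q) (FPQ (imgs (G w) P) (imgs (G w) Q)) /\
          (forall p, p \in P ->
             approx_sol beta (imgs (G w) P) (imgs (G w) Q) (p *m G w) ->
             approx_sol (C * alpha) P Q p)] in
        measurable good /\ ((2 / 3 : R)%:E <= Pr good)%E.
Proof.
(* 336 * alpha bounds the operator norm and [beta] is the loss in (2); the same constant covers t <=
   115 u + 1 <= 116 u. *)
exists (336 * beta); split; first by lra.
move=> d k n alpha d1 alpha1 k1 kn.
pose u : R := 1 + ln k%:R + d%:R / alpha ^+ 2.
have lnk0 : 0 <= ln (k%:R : R) by rewrite ln_ge0// ler1n.
have dal0 : 0 <= d%:R / alpha ^+ 2 by rewrite divr_ge0// exprn_ge0//; lra.
have u1 : 1 <= u by rewrite /u; lra.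
(* [115 = 5 * 23] makes [k * expR (- (t / 23))] at most [expR (- 5) <= 1 / 6]. *)
pose t := (Num.truncn (115 * u)).+1.
have /andP[tle tgt] : (Num.truncn (115 * u))%:R <= 115 * u < t%:R.
  by apply: truncn_itv; lra.
pose w0 : {ffun 'I_t -> {ffun 'I_d -> bool}} := [ffun=> [ffun=> true]].
pose A i : 'M[R]_(d, t) :=
  signmx (nth w0 (enum {ffun 'I_t -> {ffun 'I_d -> bool}}) i).
exists t, _, nat, (uniform_nat R #|{ffun 'I_t -> {ffun 'I_d -> bool}}|.-1),
  (fun i : nat => (2 / Num.sqrt t%:R) *: A i).
split; first by rewrite -/u /t -natr1; nra.
move=> P Q _ Pn _ Qk good; split => //.
have Q0 : (0 < size Q)%N by rewrite Qk.
have P0 : (0 < size P)%N by rewrite Pn (leq_trans k1).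
have [p pP pE] := FPQ_attained R d P Q P0 Q0.
(* The point [p] depends on P and Q but not on the signs, so these are k vectors fixed before the
   matrix is drawn. *)
pose X := [seq p - q | q <- Q].
have d0 : (0 < d)%N := ltnW d1.
have := signmx_good_prob R d t X d0 (ltn0Sn _).
set prb := prob _ => Hprb.
apply: (@le_trans _ _ prb%:E).
  (* The failure of some lower bound costs at most 1/6, and 5/6 - 1/6 = 2/3. *)
  rewrite lee_fin; apply: le_trans Hprb.
  have : (size X)%:R * expR (- (t%:R / 23)) <= 6^-1 :> R.
    rewrite size_map Qk.
    have k0 : 0 < k%:R :> R by rewrite ltr0n.
    apply: (@le_trans _ _ (k%:R * expR (- 5 - ln k%:R))).
      by rewrite ler_wpM2l// ler_expR; move: tgt; rewrite /u; lra.
    rewrite expRD [expR (- ln _)]expRN lnK ?posrE// mulrCA mulfV ?gt_eqF// mulr1.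
    rewrite expRN lef_pV2 ?posrE ?expR_gt0//.
    by apply: le_trans (expR_ge1Dx _); lra.
  lra.
pose Good : set {ffun 'I_t -> {ffun 'I_d -> bool}} := [set w |
  (forall x : 'rV[R]_d, sqn (x *m signmx w) <=
     84 ^+ 2 * (d%:R + t%:R) * sqn x) /\
  {in X, forall x, t%:R / 4 * sqn x <= sqn (x *m signmx w)}].
rewrite -[prb%:E](uniform_nat_mean R _ w0 Good).
apply: le_measure; rewrite ?inE//.
move=> i /= [Hup Hlow].
apply: (@furthest_point_preserved _ _ _ _ (336 * alpha) _ _ _ _ p) => //.
- by move=> v; apply: scaled_signmx_le => //; [exact: ltW | move: tgt; rewrite /u; lra].
- by move=> q qQ; apply: scaled_signmx_ge => //; apply: Hlow; apply: map_f.
- lra.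
- lra.
Qed.
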